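(* Given a graph $G$, a constant $\beta>0$, a vector $(v_i)_{i=1}^n$ and a symmetric matrix $(w_{ij})_{1\le i,j\le n}$, the gradient flow of the discrete free energy $$\mathcal{F}(\rho)=\sum_{i=1}^n v_i\rho_i+\frac12\sum_{i=1}^n\sum_{j=1}^n w_{ij}\rho_i\rho_j+\beta\sum_{i=1}^n\rho_i\log\rho_i$$ on $(\mathcal{P}_o(G),W_2)$ is $$\frac{d\rho_i}{dt}=\frac{1}{\Delta x^2}\Big\{\sum_{j\in N(i)}\rho_j\,(F_j(\rho)-F_i(\rho))_+-\sum_{j\in N(i)}\rho_i\,(F_i(\rho)-F_j(\rho))_+\Big\}\qquad\text{for every } i\in V,$$ where $F_i(\rho)=\frac{\partial}{\partial\rho_i}\mathcal{F}(\rho)=v_i+\sum_{j=1}^n w_{ij}\rho_j+\beta\log\rho_i+\beta$.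
   Context: $G=(V,E)$ is a finite, undirected, simple, connected graph with $V=\{1,\dots,n\}$; $E$ is a set of ordered pairs containing both $(i,j)$ and $(j,i)$ for each edge, and $N(i)=\{j\in V:(i,j)\in E\}$. $\Delta x>0$ is a fixed constant and $(a)_+=\max\{a,0\}$. $\mathcal{P}_o(G)=\{\rho\in\mathbb{R}^n:\sum_i\rho_i=1,\ \rho_i>0\ \forall i\}$, with tangent space $T_\rho\mathcal{P}_o(G)=\{\sigma\in\mathbb{R}^n:\sum_i\sigma_i=0\}$. For $j\in N(i)$: $g_{ij}(\rho)=\rho_i$ if $F_i(\rho)>F_j(\rho)$; $g_{ij}(\rho)=\rho_j$ if $F_i(\rho)<F_j(\rho)$; $g_{ij}(\rho)=\frac{\rho_i+\rho_j}{2}$ if $F_i(\rho)=F_j(\rho)$. Let $\mathbb{R}^n/\!\sim$ be the quotient of $\mathbb{R}^n$ modulo additive constants (i.e. modulo $\mathbb{R}(1,\dots,1)$). For each $\rho\in\mathcal{P}_o(G)$ the map $\tau:\mathbb{R}^n/\!\sim\,\to T_\rho\mathcal{P}_o(G)$, $\tau([\Phi])=\big(\frac{1}{\Delta x^2}\sum_{j\in N(i)}(\Phi_i-\Phi_j)g_{ij}(\rho)\big)_{i=1}^n$, is a linear isomorphism. The inner product on $T_\rho\mathcal{P}_o(G)$ is $$g(\sigma^1,\sigma^2)=\sum_{i=1}^n\sigma_i^1\Phi_i^2=\frac{1}{2\Delta x^2}\sum_{(i,j)\in E}g_{ij}(\rho)(\Phi_i^1-\Phi_j^1)(\Phi_i^2-\Phi_j^2),\qquad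 \sigma^a=\tau([\Phi^a]),\ a=1,2.$$ The discrete 2-Wasserstein metric $W_2$ is the induced distance: $W_2(\rho^0,\rho^1)^2=\inf\int_0^1 g(\dot\rho,\dot\rho)\,dt$ over continuously differentiable curves $\rho:[0,1]\to\mathcal{P}_o(G)$ from $\rho^0$ to $\rho^1$. The gradient flow of $\mathcal{F}$ on $(\mathcal{P}_o(G),W_2)$ is the equation $\frac{d\rho}{dt}=-\mathrm{grad}\,\mathcal{F}(\rho)$, where $\mathrm{grad}\,\mathcal{F}(\rho)\in T_\rho\mathcal{P}_o(G)$ is defined by $g(\mathrm{grad}\,\mathcal{F}(\rho),\sigma)=\sum_{i=1}^n F_i(\rho)\sigma_i$ for all $\sigma\in T_\rho\mathcal{P}_o(G)$. *)

(* Defs.v *)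
From HB Require Import structures.
From mathcomp Require Import all_boot all_order all_algebra.
From mathcomp Require Import generic_quotient.
From mathcomp Require Import all_classical all_reals all_analysis.

Set Implicit Arguments.
Unset Strict Implicit.
Unset Printing Implicit Defensive.

Import Order.TTheory GRing.Theory Num.Theory.
Import numFieldNormedType.Exports.

Local Open Scope classical_set_scope.
Local Open Scope ring_scope.
Local Open Scope quotient_scope.

Section PotentialClasses.
Context {R : realType} {n : nat}.

Definition addconst (Phi Psi : 'rV[R]_n) : bool :=
  `[< exists c : R, Psi = Phi + const_mx c >].

Lemma addconst_refl : reflexive addconst.
Proof.
move=> Phi; apply/asboolP; exists 0.
by apply/rowP => i; rewrite !mxE addr0.
Qed.

Lemma addconst_sym : symmetric addconst.
Proof.
have H Phi Psi : addconst Phi Psi -> addconst Psi Phi.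
  move=> /asboolP[c ->]; apply/asboolP; exists (- c).
  by apply/rowP => i; rewrite !mxE addrK.
by move=> Phi Psi; apply/idP/idP; exact: H.
Qed.

Lemma addconst_trans : transitive addconst.
Proof.
move=> Psi Phi Chi /asboolP[c ->] /asboolP[d ->]; apply/asboolP.
by exists (c + d); apply/rowP => i; rewrite !mxE addrA.
Qed.

Canonical addconst_equiv :=
  EquivRel addconst addconst_refl addconst_sym addconst_trans.

(* R^n modulo R(1, ..., 1) *)
Definition potential := {eq_quot addconst}.

End PotentialClasses.
Arguments potential : clear implicits.

Section Wasserstein.
Context {R : realType} {n : nat}.
(* The graph on 'I_n with adjacency relation e, the mesh size dx, and the
   functional calF whose partial derivatives select the edge weights. *)
Variables (e : rel 'I_n) (dx : R) (calF : 'rV[R]_n -> R).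
Implicit Types (rho sigma xi Phi : 'rV[R]_n) (i j : 'I_n).

Definition prob_interior : set 'rV[R]_n :=
  [set rho | \sum_i rho 0 i = 1 /\ forall i, 0 < rho 0 i].

Definition tangent : set 'rV[R]_n := [set sigma | \sum_i sigma 0 i = 0].

Definition partial rho i : R := 'D_(delta_mx 0 i) calF rho.

Definition edge_weight rho i j : R :=
  if partial rho i > partial rho j then rho 0 i
  else if partial rho i < partial rho j then rho 0 j
  else (rho 0 i + rho 0 j) / 2.

Definition tau rho (q : potential R n) : 'rV[R]_n :=
  \row_i ((dx ^+ 2)^-1 *
    \sum_(j | e i j) (repr q 0 i - repr q 0 j) * edge_weight rho i j).

(* tau does not depend on the representative used in its definition. *)
Lemma tau_pi rho Phi : tau rho (\pi_(potential R n) Phi) =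
  \row_i ((dx ^+ 2)^-1 *
    \sum_(j | e i j) (Phi 0 i - Phi 0 j) * edge_weight rho i j).
Proof.
have : addconst Phi (repr (\pi_(potential R n) Phi)).
  by rewrite -eqmodE reprK.
move=> /asboolP[c Phic]; apply/rowP => i; rewrite !mxE; congr (_ * _); apply: eq_bigr => j _.
by rewrite Phic !mxE opprD addrACA subrr addr0.
Qed.

(* For rho in the open simplex, e connected and sigma tangent, there is exactly
   one q with tau rho q = sigma; outside this range the value is junk. *)
Definition tau_inv rho sigma : potential R n :=
  xget (\pi_(potential R n) 0) [set q | tau rho q = sigma].

(* For sigma1 tangent the sum does not depend on the representative. *)
Definition wmetric rho sigma1 sigma2 : R :=
  \sum_i sigma1 0 i * repr (tau_inv rho sigma2) 0 i.

Definition is_gradient rho xi : Prop :=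
  tangent xi /\ forall sigma, tangent sigma ->
    wmetric rho xi sigma = \sum_i partial rho i * sigma 0 i.

Definition grad rho : 'rV[R]_n := xget 0 (is_gradient rho).

(* One-sided at an endpoint of D, so that initial value problems on
   intervals such as [0, T[ are covered. *)
Definition has_derivative_in (V : normedModType R) (D : set R) (f : R -> V)
    (t : R) (l : V) : Prop :=
  (fun s => (s - t)^-1 *: (f s - f t)) @ within D t^' --> l.

Definition is_gradient_flow (D : set R) (rho : R -> 'rV[R]_n) : Prop :=
  forall t, D t -> has_derivative_in D rho t (- grad (rho t)).

Definition flow_rhs rho i : R :=
  (dx ^+ 2)^-1 *
    (\sum_(j | e i j) rho 0 j * Num.max (partial rho j - partial rho i) 0
     - \sum_(j | e i j) rho 0 i * Num.max (partial rho i - partial rho j) 0).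

End Wasserstein.

Definition free_energy {R : realType} {n : nat} (v : 'rV[R]_n) (w : 'M[R]_n)
    (beta : R) (rho : 'rV[R]_n) : R :=
  \sum_i v 0 i * rho 0 i
  + 2^-1 * \sum_i \sum_j w i j * rho 0 i * rho 0 j
  + beta * \sum_i rho 0 i * ln (rho 0 i).

(* Main.v *)
Require Import Defs.
From HB Require Import structures.
From mathcomp Require Import all_boot all_order all_algebra.
From mathcomp Require Import generic_quotient ring.
From mathcomp Require Import all_classical all_reals all_analysis.

(** For fixed rho, the map tau is the Laplacian L of the graph whose edges
    carry the weights g_ij(rho) / dx^2 ([tau_laplacian]).  These weights are
    symmetric and positive, so L is self-adjoint ([laplacian_selfadjoint]) and,
    the graph being connected, L has the constants as kernel ([laplacian_ker])
    and the vectors of sum 0 as range ([laplacian_surj]).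

    Let F be the vector of partial derivatives of the functional.  If
    sigma = L Phi, self-adjointness gives
    sum_i F_i sigma_i = sum_i (L F)_i Phi_i, and the right-hand side is
    g (L F, sigma): the gradient is L F, and it is the only one because the
    metric is nondegenerate ([gradient_laplacian]).

    It remains to compute L F.  The weight g_ij is the density at the end of
    the edge where F is larger, so (F_i - F_j) g_ij is
    rho_i (F_i - F_j)_+ - rho_j (F_j - F_i)_+, and - L F is the right-hand side
    of the equation ([laplacian_partials]).  Up to here the functional is
    arbitrary; for the free energy, F is computed in [is_derive_free_energy].
    The vector equation is equivalent to the system of its coordinates because
    limits of row vectors are taken coordinatewise ([cvg_rowP]). *)

Set Implicit Arguments.
Unset Strict Implicit.

Import Order.TTheory GRing.Theory Num.Theory.
Import numFieldNormedType.Exports.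

Local Open Scope classical_set_scope.
Local Open Scope ring_scope.

(** * The weighted graph Laplacian *)

Definition laplacian (R : pzRingType) (n : nat) (e : rel 'I_n)
    (c : 'I_n -> 'I_n -> R) (Phi : 'rV[R]_n) : 'rV[R]_n :=
  \row_i \sum_(j | e i j) c i j * (Phi 0 i - Phi 0 j).

Definition laplacian_mx (R : pzRingType) (n : nat) (e : rel 'I_n)
    (c : 'I_n -> 'I_n -> R) : 'M[R]_n :=
  \matrix_(k, i) \sum_(j | e i j) c i j * ((k == i)%:R - (k == j)%:R).

Lemma sum_delta (R : pzRingType) (n : nat) (f : 'I_n -> R) (i : 'I_n) :
  \sum_j f j * (j == i)%:R = f i.
Proof.
rewrite (bigD1 i)//= eqxx mulr1 big1 ?addr0// => j /negbTE ->.
by rewrite mulr0.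
Qed.

Section Laplacian.
Variables (R : realFieldType) (n : nat) (e : rel 'I_n).
Variable c : 'I_n -> 'I_n -> R.
Hypothesis e_sym : symmetric e.
Hypothesis c_sym : forall i j, c i j = c j i.
Implicit Types Phi Psi sigma : 'rV[R]_n.

Lemma laplacianE Phi : laplacian e c Phi = Phi *m laplacian_mx e c.
Proof.
apply/rowP => i; rewrite !mxE.
under [RHS]eq_bigr do rewrite mxE mulr_sumr.
rewrite exchange_big; apply: eq_bigr => j _ /=.
transitivity (c i j * \sum_k (Phi 0 k * (k == i)%:R - Phi 0 k * (k == j)%:R)).
  by rewrite sumrB !sum_delta.
by rewrite mulr_sumr; apply: eq_bigr => k _; ring.
Qed.

(** Summation by parts: exchanging the two ends of every edge sends the sum
    of c i j * (Phi i - Phi j) * Psi i to that of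
    - c i j * (Phi i - Phi j) * Psi j, and the average of the two expressions
    is the Dirichlet form.  For positive weights it is nonnegative at
    Phi = Psi, which is what determines the kernel. *)
Lemma dirichlet_form Phi Psi :
  \sum_i laplacian e c Phi 0 i * Psi 0 i =
  2^-1 * \sum_i \sum_(j | e i j)
           c i j * (Phi 0 i - Phi 0 j) * (Psi 0 i - Psi 0 j).
Proof.
set S := LHS.
have S1 : S = \sum_i \sum_(j | e i j) c i j * (Phi 0 i - Phi 0 j) * Psi 0 i.
  by apply: eq_bigr => i _; rewrite mxE mulr_suml.
have S2 : S = \sum_i \sum_(j | e i j) - (c i j * (Phi 0 i - Phi 0 j) * Psi 0 j).
  rewrite S1 (exchange_big_dep xpredT)//=; apply: eq_bigr => j _.
  under eq_bigl do rewrite e_sym.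
  by apply: eq_bigr => i _; rewrite (c_sym i j); ring.
suff -> : \sum_i \sum_(j | e i j)
    c i j * (Phi 0 i - Phi 0 j) * (Psi 0 i - Psi 0 j) = S + S by field.
rewrite {1}S1 S2 -big_split; apply: eq_bigr => i _ /=.
by rewrite -big_split; apply: eq_bigr => j _ /=; ring.
Qed.

Lemma laplacian_selfadjoint Phi Psi :
  \sum_i laplacian e c Phi 0 i * Psi 0 i =
  \sum_i laplacian e c Psi 0 i * Phi 0 i.
Proof.
rewrite !dirichlet_form; congr (_ * _); apply: eq_bigr => i _.
by apply: eq_bigr => j _; ring.
Qed.

Lemma laplacian_sum0 Phi : \sum_i laplacian e c Phi 0 i = 0.
Proof.
transitivity (\sum_i laplacian e c Phi 0 i * (const_mx 1 : 'rV[R]_n) 0 i).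
  by apply: eq_bigr => i _; rewrite [X in _ * X]mxE mulr1.
rewrite dirichlet_form big1 ?mulr0// => i _; rewrite big1// => j _.
by rewrite !mxE subrr mulr0.
Qed.

Hypothesis e_conn : forall i j : 'I_n, connect e i j.
Hypothesis c_gt0 : forall i j, e i j -> 0 < c i j.

(** A Phi in the kernel has zero Dirichlet energy, so Phi takes the same value
    at both ends of every edge, hence along every path. *)
Lemma laplacian_ker Phi i j : laplacian e c Phi = 0 -> Phi 0 i = Phi 0 j.
Proof.
move=> Phi0.
have ge0 k l : e k l -> 0 <= c k l * (Phi 0 k - Phi 0 l) * (Phi 0 k - Phi 0 l).
  by move=> /c_gt0/ltW ckl; rewrite -mulrA mulr_ge0// -expr2 sqr_ge0.
have step k l : e k l -> Phi 0 k = Phi 0 l.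
  move=> ekl; have /esym := dirichlet_form Phi Phi.
  rewrite Phi0 [RHS]big1 => [|m _]; last by rewrite mxE mul0r.
  move/eqP; rewrite mulf_eq0 invr_eq0 pnatr_eq0/= => /eqP.
  move/psumr_eq0P => /(_ (fun m _ => sumr_ge0 _ (ge0 m))).
  move=> /(_ k isT) /psumr_eq0P => /(_ (ge0 k)) /(_ l ekl) /eqP.
  rewrite -mulrA mulf_eq0 (gt_eqF (c_gt0 ekl))/= -expr2 sqrf_eq0 subr_eq0.
  by move/eqP.
have /connectP[p + ->] := e_conn i j.
by elim: p i => [//|k p IH] i /= /andP[/step -> /IH].
Qed.

(** Adding the all-ones matrix to the Laplacian makes it invertible: the two
    summands have ranges meeting only at 0, namely the rows of sum 0 and the
    constant rows, and their kernels meet only at 0 as well, namely the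
    constants and the rows of sum 0.  A solution for the perturbed matrix with
    a right-hand side of sum 0 has sum 0 itself, so the perturbation vanishes
    on it. *)
Lemma laplacian_surj sigma : \sum_i sigma 0 i = 0 ->
  exists Phi, laplacian e c Phi = sigma.
Proof.
move=> sigma0.
have [n0|n_gt0] := posnP n.
  by exists 0; apply/rowP => i; have := ltn_ord i; rewrite {2}n0.
have n_neq0 : n%:R != 0 :> R by rewrite pnatr_eq0 -lt0n.
set B : 'M[R]_n := laplacian_mx e c + const_mx 1.
have BE Phi i : (Phi *m B) 0 i = laplacian e c Phi 0 i + \sum_k Phi 0 k.
  rewrite mulmxDr -laplacianE mxE; congr (_ + _); rewrite mxE.
  by apply: eq_bigr => k _; rewrite mxE mulr1.
have B_lap Phi : \sum_i (Phi *m B) 0 i = 0 -> laplacian e c Phi = Phi *m B.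
  move=> PhiB0; suff Phi0 : \sum_k Phi 0 k = 0.
    by apply/rowP => i; rewrite BE Phi0 addr0.
  move: PhiB0; under eq_bigr do rewrite BE.
  rewrite big_split/= laplacian_sum0 add0r sumr_const card_ord -mulr_natl.
  by move/eqP; rewrite mulf_eq0 (negbTE n_neq0) => /eqP.
have B_unit : B \in unitmx.
  rewrite -row_free_unit; apply: inj_row_free => Phi PhiB0.
  have lap0 : laplacian e c Phi = 0.
    by rewrite B_lap// PhiB0 big1// => i _; rewrite mxE.
  apply/rowP => i; rewrite mxE; have /rowP /(_ i) := PhiB0.
  rewrite BE lap0 !mxE add0r.
  under eq_bigr do rewrite (laplacian_ker _ i lap0).
  rewrite sumr_const card_ord -mulr_natl => /eqP.
  by rewrite mulf_eq0 (negbTE n_neq0) => /eqP.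
exists (sigma *m invmx B).
by rewrite B_lap mulmxKV.
Qed.

End Laplacian.

(** * The gradient for the Wasserstein metric *)

Section Gradient.
Variables (R : realType) (n : nat) (e : rel 'I_n).
Hypothesis e_sym : symmetric e.
Hypothesis e_conn : forall i j : 'I_n, connect e i j.
Variables (dx : R) (calF : 'rV[R]_n -> R).
Hypothesis dx_gt0 : 0 < dx.

(** The factor 1 / dx^2 is absorbed in the weights, so that tau is exactly the
    Laplacian of these weights. *)
Definition conductance (rho : 'rV[R]_n) (i j : 'I_n) : R :=
  (dx ^+ 2)^-1 * edge_weight calF rho i j.

Lemma tau_laplacian rho Phi :
  tau e dx calF rho (\pi_(potential R n)%qT Phi) =
  laplacian e (conductance rho) Phi.
Proof.
rewrite tau_pi; apply/rowP => i; rewrite !mxE mulr_sumr.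
by apply: eq_bigr => j _; rewrite /conductance; ring.
Qed.

Lemma conductance_sym rho i j : conductance rho i j = conductance rho j i.
Proof.
rewrite /conductance /edge_weight; congr (_ * _).
by case: ltgtP => // _; rewrite addrC.
Qed.

Lemma conductance_gt0 rho i j : prob_interior rho -> 0 < conductance rho i j.
Proof.
move=> [_ rho_gt0]; rewrite /conductance mulr_gt0 ?invr_gt0 ?exprn_gt0//.
rewrite /edge_weight; case: ifP => // _; case: ifP => // _.
by rewrite divr_gt0 ?addr_gt0.
Qed.

Definition partials (rho : 'rV[R]_n) : 'rV[R]_n := \row_i partial calF rho i.

(** This is where the upwind choice of the weights enters: the larger of F i
    and F j decides whether rho i or rho j multiplies F i - F j, which produces
    the positive parts; when they are equal the weight is multiplied by 0. *)
Lemma laplacian_partials rho i :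
  laplacian e (conductance rho) (partials rho) 0 i = - flow_rhs e dx calF rho i.
Proof.
rewrite mxE /flow_rhs -sumrB mulr_sumr -sumrN; apply: eq_bigr => j _.
rewrite !mxE /conductance /edge_weight; set a := partial _ _ i.
set b := partial _ _ j; case: (ltgtP b a) => [ba|ab|->].
- rewrite (@max_r _ _ (b - a)) ?subr_le0 1?ltW// max_l ?subr_ge0 1?ltW//; ring.
- rewrite (@max_l _ _ (b - a)) ?subr_ge0 1?ltW// max_r ?subr_le0 1?ltW//; ring.
- by rewrite subrr maxxx; ring.
Qed.

Lemma tau_invK rho sigma : prob_interior rho -> tangent sigma ->
  tau e dx calF rho (tau_inv e dx calF rho sigma) = sigma.
Proof.
move=> rhoP sigma0.
have [Phi PhiE] := laplacian_surj e_sym (conductance_sym rho) e_conn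
  (fun i j _ => conductance_gt0 i j rhoP) sigma0.
rewrite /tau_inv; apply: (@xgetPex _ _ [set q | tau e dx calF rho q = sigma]).
by exists (\pi_(potential R n)%qT Phi); rewrite /= tau_laplacian.
Qed.

Lemma laplacian_repr_tau_inv rho sigma : prob_interior rho -> tangent sigma ->
  laplacian e (conductance rho) (repr (tau_inv e dx calF rho sigma)) = sigma.
Proof.
by move=> rhoP sigma0; rewrite -tau_laplacian reprK tau_invK.
Qed.

(** If sigma = L Phi with L the Laplacian, then g (L F, sigma) is the sum of
    (L F) i * Phi i, which by self-adjointness is the sum of F i * sigma i:
    so L F is a gradient.  Uniqueness is the nondegeneracy of the metric: if d
    is the difference of two gradients and d = L D, testing against
    sigma = L d gives the sum of (L D) i * d i, that is of d i ^ 2. *)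
Lemma gradient_laplacian rho xi : prob_interior rho ->
  is_gradient e dx calF rho xi <->
  xi = laplacian e (conductance rho) (partials rho).
Proof.
move=> rhoP; set lap := laplacian e (conductance rho).
have lap_sym := laplacian_selfadjoint e_sym (conductance_sym rho).
have lap_tan Phi : tangent (lap Phi).
  exact: (laplacian_sum0 e_sym (conductance_sym rho)).
have pairing sigma : tangent sigma ->
    \sum_i partial calF rho i * sigma 0 i =
    wmetric e dx calF rho (lap (partials rho)) sigma.
  move=> /(laplacian_repr_tau_inv rhoP) sigmaE.
  rewrite /wmetric lap_sym sigmaE; apply: eq_bigr => i _.
  by rewrite mxE mulrC.
split=> [[xi_tan xi_grad]|->]; last by split=> // sigma /pairing ->.
pose d := xi - lap (partials rho).
have d_tan : tangent d.
  have := lap_tan (partials rho); rewrite /tangent/= => lapF0.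
  under eq_bigr do rewrite mxE [X in _ + X]mxE.
  by rewrite sumrB xi_tan lapF0 subrr.
have d_orth sigma : tangent sigma -> wmetric e dx calF rho d sigma = 0.
  move=> sigma_tan; rewrite /wmetric.
  under eq_bigr do rewrite mxE [X in _ + X]mxE mulrBl.
  by rewrite sumrB -!/(wmetric _ _ _ _ _ _) xi_grad// pairing// subrr.
have [D DE] := laplacian_surj e_sym (conductance_sym rho) e_conn
  (fun i j _ => conductance_gt0 i j rhoP) d_tan.
have := d_orth _ (lap_tan d).
rewrite /wmetric -{1}DE lap_sym laplacian_repr_tau_inv// lap_sym DE.
move=> /psumr_eq0P d_sq0; apply/rowP => i; apply/eqP; rewrite -subr_eq0.
have : d 0 i * d 0 i = 0 by apply: d_sq0 => // k _; rewrite -expr2 sqr_ge0.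
by rewrite !mxE => /eqP; rewrite mulf_eq0 orbb.
Qed.

Lemma gradient_flow_rhs rho xi : prob_interior rho ->
  is_gradient e dx calF rho xi <->
  forall i, - xi 0 i = flow_rhs e dx calF rho i.
Proof.
move=> rhoP; rewrite gradient_laplacian//; split=> [-> i|xiE].
  by rewrite laplacian_partials opprK.
by apply/rowP => i; rewrite laplacian_partials -xiE opprK.
Qed.

Lemma grad_flow_rhs rho : prob_interior rho ->
  - grad e dx calF rho = \row_i flow_rhs e dx calF rho i.
Proof.
move=> rhoP.
have gradP : is_gradient e dx calF rho (grad e dx calF rho).
  apply: (@xgetPex _ 0 (is_gradient e dx calF rho)).
  by exists (laplacian e (conductance rho) (partials rho)); exact/gradient_laplacian.
by apply/rowP => i; rewrite !mxE; exact: (proj1 (gradient_flow_rhs _ rhoP) gradP).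
Qed.

End Gradient.

(** * Derivatives of curves and of the free energy *)

Lemma cvg_rowP (R : realType) (n : nat) (T : Type) (F : set_system T)
    (f : T -> 'rV[R]_n) (l : 'rV[R]_n) : Filter F ->
  (f @ F --> l) <-> (forall i, (fun t => f t 0 i) @ F --> l 0 i).
Proof.
move=> FF; split=> [fl i|fl].
  exact: (cvg_comp f (fun M : 'rV[R]_n => M 0 i) fl (coord_continuous (x := l))).
move=> A [P lP PA]; apply: filterS (fun t => @PA (f t)) _.
have : \forall t \near F, forall i, P 0 i (f t 0 i).
  by apply: filter_forall => i; exact: fl.
by apply: filterS => t fP i j; rewrite ord1.
Qed.

Lemma has_derivative_in_rowP (R : realType) (n : nat) (D : set R)
    (f : R -> 'rV[R]_n) (t : R) (l : 'rV[R]_n) :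
  has_derivative_in D f t l <->
  forall i, has_derivative_in D (fun s => f s 0 i) t (l 0 i).
Proof.
rewrite /has_derivative_in cvg_rowP.
have E i : (fun s => ((s - t)^-1 *: (f s - f t)) 0 i) =
    (fun s => (s - t)^-1 *: (f s 0 i - f t 0 i)).
  by apply/funext => s; rewrite !mxE.
by split=> fl i; have := fl i; rewrite E.
Qed.

(** A directional derivative only sees the restriction to a line, so that the
    one-variable chain rule applies to the logarithms of the entropy. *)
Lemma is_derive_line (R : realType) (V W : normedModType R) (f : V -> W)
    (x v : V) (df : W) :
  is_derive (0 : R) (1 : R) (fun h : R => f (h *: v + x)) df ->
  is_derive x v f df.
Proof.
have E : (fun h : R => h^-1 *: (((fun k : R => f (k *: v + x)) \o shift 0)
    (h *: (1 : R)) - f (0 *: v + x))) =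
    (fun h => h^-1 *: ((f \o shift x) (h *: v) - f x)).
  by apply/funext => h /=; rewrite addr0 scaler1 scale0r add0r.
by move=> [dv dE]; split; [move: dv|move: dE]; rewrite /derivable /derive E.
Qed.

Lemma is_derive_free_energy (R : realType) (n : nat) (v : 'rV[R]_n)
    (w : 'M[R]_n) (beta : R) (w_sym : forall i j, w i j = w j i)
    (rho : 'rV[R]_n) (i : 'I_n) : (forall j, 0 < rho 0 j) ->
  is_derive rho (delta_mx 0 i : 'rV[R]_n) (free_energy v w beta)
    (v 0 i + \sum_j w i j * rho 0 j + beta * ln (rho 0 i) + beta).
Proof.
move=> rho_gt0; apply: is_derive_line.
pose x (j : 'I_n) : R -> R := fun h => h * (j == i)%:R + rho 0 j.
have x0 j : x j 0 = rho 0 j by rewrite /x mul0r add0r.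
have d_x j : is_derive (0 : R) (1 : R) (x j) (j == i)%:R.
  rewrite (_ : x j = (j == i)%:R *: id + cst (rho 0 j)).
    by apply: is_derive_eq; rewrite addr0 scaler1.
  by apply/funext => h; rewrite /x mulrC.
have d_lnx j : is_derive (0 : R) (1 : R) (@ln R \o x j) ((j == i)%:R * (rho 0 j)^-1).
  have dln : is_derive (x j 0) 1 (@ln R) (rho 0 j)^-1 by rewrite x0; exact: is_derive1_ln.
  have := @is_derive1_comp R (@ln R) (x j) 0 (rho 0 j)^-1 (j == i)%:R dln (d_x j).
  by rewrite mulrC.
rewrite (_ : (fun h => _) =
    \sum_j v 0 j *: x j + 2^-1 *: (\sum_j \sum_k w j k *: (x j * x k)) +
    beta *: \sum_j x j * (@ln R \o x j)); last first.
  apply/funext => h; rewrite /free_energy.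
  have xE j : (h *: delta_mx 0 i + rho) 0 j = x j h by rewrite !mxE.
  rewrite !fctE !fct_sumE; congr (_ + _ * _ + _ * _).
  - by apply: eq_bigr => j _; rewrite xE.
  - apply: eq_bigr => j _; rewrite fct_sumE; apply: eq_bigr => k _.
    by rewrite !xE -mulrA.
  - by apply: eq_bigr => j _; rewrite xE.
apply: is_derive_eq.
have scaleE (a b : R) : a *: b = a * b by [].
(* Both indices of the quadratic form are differentiated; the symmetry of w
   makes the two contributions equal, which cancels the factor 1/2. *)
have quadratic : \sum_j \sum_k w j k *: (x j 0 *: (k == i)%:R + x k 0 *: (j == i)%:R)
    = \sum_j w i j * rho 0 j + \sum_j w i j * rho 0 j.
  transitivity (\sum_j w j i * rho 0 j +
      \sum_j (\sum_k w j k * rho 0 k) * (j == i)%:R).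
    rewrite -big_split; apply: eq_bigr => j _ /=.
    rewrite -(sum_delta (fun k => w j k * rho 0 j) i) mulr_suml -big_split.
    by apply: eq_bigr => k _ /=; rewrite !scaleE !x0; ring.
  by rewrite sum_delta; congr (_ + _); apply: eq_bigr => j _; rewrite w_sym.
have entropy : \sum_j (x j 0 *: ((j == i)%:R / rho 0 j) +
    (@ln R \o x j) 0 *: (j == i)%:R) = 1 + ln (rho 0 i).
  rewrite -(sum_delta (fun j => 1 + ln (rho 0 j)) i).
  apply: eq_bigr => j _; rewrite !scaleE /= x0.
  by field; rewrite gt_eqF.
rewrite quadratic entropy !scaleE sum_delta.
by field.
Qed.

Unset Implicit Arguments.
Set Strict Implicit.

Theorem theorem4 (R : realType) (n : nat) (e : rel 'I_n)
    (e_sym : symmetric e) (e_irr : irreflexive e)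
    (e_conn : forall i j : 'I_n, connect e i j)
    (dx : R) (dx_gt0 : 0 < dx) (beta : R) (beta_gt0 : 0 < beta)
    (v : 'rV[R]_n) (w : 'M[R]_n) (w_sym : forall i j, w i j = w j i) :
  let calF := free_energy v w beta in
  [/\ (* F_i is the i-th partial derivative of the free energy *)
      forall rho : 'rV[R]_n, prob_interior rho -> forall i : 'I_n,
        is_derive rho (delta_mx 0 i : 'rV[R]_n) calF
          (v 0 i + \sum_j w i j * rho 0 j + beta * ln (rho 0 i) + beta),
      (* the gradient exists, is unique, and its opposite is the right-hand
         side of the equation *)
      forall rho xi : 'rV[R]_n, prob_interior rho ->
        (is_gradient e dx calF rho xi <->
         forall i : 'I_n, - xi 0 i = flow_rhs e dx calF rho i)
    & (* the gradient flow equation is the displayed system *)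
      forall (I : interval R) (rho : R -> 'rV[R]_n),
        (forall t, t \in I -> prob_interior (rho t)) ->
        (is_gradient_flow e dx calF [set` I] rho <->
         forall t, t \in I -> forall i : 'I_n,
           has_derivative_in [set` I] (fun s => rho s 0 i) t
             (flow_rhs e dx calF (rho t) i))].
Proof.
move=> calF; split.
- by move=> rho [_ rho_gt0] i; exact: is_derive_free_energy.
- by move=> rho xi rhoP; exact: gradient_flow_rhs.
move=> I rho rhoP; split=> flow t tI.
  move=> i; have := flow t tI; rewrite grad_flow_rhs//; last exact: rhoP.
  by move=> /has_derivative_in_rowP /(_ i); rewrite mxE.
rewrite grad_flow_rhs//; last exact: rhoP.
by apply/has_derivative_in_rowP => i; rewrite mxE; exact: flow.
Qed.
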